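(* Let $\mathcal{C} = (S_{\mathcal C}, \Sigma_{\mathcal C}, \mathit{next}_{\mathcal C}, \mathit{leak}_{\mathcal C})$ and $\mathcal{H} = (S_{\mathcal H}, \Sigma_{\mathcal H}, \mathit{next}_{\mathcal H}, \mathit{leak}_{\mathcal H})$ be two transition systems, and let $s_1, s_2 \in S_{\mathcal C}$ and $h_1, h_2 \in S_{\mathcal H}$. Then the implication $[\![ s_1 ]\!]_{\mathcal C} = [\![ s_2 ]\!]_{\mathcal C} \implies [\![ h_1 ]\!]_{\mathcal H} = [\![ h_2 ]\!]_{\mathcal H}$ holds if and only if there exists a relation $R \subseteq S_{\mathcal C} \times S_{\mathcal C} \times S_{\mathcal H} \times S_{\mathcal H}$ such that $(s_1, s_2, h_1, h_2) \in R$ and $R \subseteq \mathtt{rbisimF}(R)$.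
   Context: A transition system is a tuple $\mathcal T = (S, \Sigma, \mathit{next}, \mathit{leak})$, where $S$ is a set of states, $\Sigma$ is a set of observations, $\mathit{next} : S \to S$ is a transition function and $\mathit{leak} : S \to \Sigma$ is a leakage function. For $s \in S$, the infinite leakage trace $[\![ s ]\!]_{\mathcal T} \in \Sigma^\omega$ is the sequence $\mathit{leak}(s)\ \mathit{leak}(\mathit{next}(s))\ \mathit{leak}(\mathit{next}^2(s)) \ldots$, i.e. its $n$-th element is $\mathit{leak}(\mathit{next}^n(s))$. For a monotone function $F$ on the powerset of a set, $\mu X.\,F(X)$ denotes its least fixpoint. For $R_1 \subseteq S_{\mathcal C} \times S_{\mathcal C} \times S_{\mathcal H} \times S_{\mathcal H}$ define $\mathtt{rbisimF}(R_1) = \mu R_2.\, \Psi(R_1,R_2)$, where $\Psi(R_1, R_2)$ is the union of the three sets (C-Leak) $\{ (s_1, s_2, h_1, h_2) \mid \mathit{leak}_{\mathcal C}(s_1) \neq \mathit{leak}_{\mathcal C}(s_2) \}$, (C-Step) $\{ (s_1, s_2, h_1, h_2) \mid (\mathit{next}_{\mathcal C}(s_1), \mathit{next}_{\mathcal C}(s_2), h_1, h_2) \in R_2 \}$, (H-Step) $\{ (s_1, s_2, h_1, h_2) \mid \mathit{leak}_{\mathcal H}(h_1) = \mathit{leak}_{\mathcal H}(h_2) \wedge (s_1, s_2, \mathit{next}_{\mathcal H}(h_1), \mathit{next}_{\mathcal H}(h_2)) \in R_1 \}$. *)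

(* Defs.v *)
From mathcomp Require Import all_boot boolp classical_sets.

Set Implicit Arguments.
Unset Strict Implicit.
Unset Printing Implicit Defensive.

Local Open Scope classical_set_scope.

Record transition_system : Type := TransitionSystem {
  state : Type;
  obs : Type;
  next : state -> state;
  leak : state -> obs
}.

Definition trace (T : transition_system) (s : state T) : nat -> obs T :=
  fun n => leak (iter n (@next T) s).

Definition is_least_fixpoint (U : Type) (F : set U -> set U) (X : set U) : Prop :=
  F X = X /\ forall Y, F Y = Y -> X `<=` Y.

(* The intersection of all fixpoints of F: it is the least fixpoint of F as
   soon as F has one, in particular when F is monotone (lfpP below). *)
Definition lfp (U : Type) (F : set U -> set U) : set U :=
  \bigcap_(X in [set X | F X = X]) X.

Lemma lfpP (U : Type) (F : set U -> set U) :
  {homo F : X Y / X `<=` Y} -> is_least_fixpoint F (lfp F).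
Proof.
move=> Fmono; pose P := \bigcap_(X in [set X | F X `<=` X]) X.
have FP : F P `<=` P.
  by move=> x FPx X FX; apply/FX/(Fmono P) => // y; apply.
have PF : F P = P.
  by apply/seteqP; split=> // x; apply; apply: Fmono.
have -> : lfp F = P.
  apply/seteqP; split=> x Hx; first exact: Hx.
  by move=> X /= FX; apply: Hx => /=; rewrite FX.
by split=> // Y FY x; apply; rewrite /= FY.
Qed.

Section RelativeBisimulation.
Variables C H : transition_system.

Definition rel4 : Type := set (state C * state C * state H * state H).

Definition C_leak : rel4 :=
  [set q | let: (s1, s2, _, _) := q in leak s1 <> leak s2].

Definition C_step (R2 : rel4) : rel4 :=
  [set q | let: (s1, s2, h1, h2) := q in R2 (next s1, next s2, h1, h2)].

Definition H_step (R1 : rel4) : rel4 :=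
  [set q | let: (s1, s2, h1, h2) := q in
           leak h1 = leak h2 /\ R1 (s1, s2, next h1, next h2)].

Definition Psi (R1 R2 : rel4) : rel4 := C_leak `|` C_step R2 `|` H_step R1.

Definition rbisimF (R1 : rel4) : rel4 := lfp (Psi R1).

Lemma Psi_homo (R1 : rel4) : {homo Psi R1 : X Y / X `<=` Y}.
Proof.
move=> X Y XY [[[s1 s2] h1] h2] [[|/= /XY]|]; by [left; left|left; right|right].
Qed.

Lemma rbisimFP (R1 : rel4) : is_least_fixpoint (Psi R1) (rbisimF R1).
Proof. exact/lfpP/Psi_homo. Qed.

End RelativeBisimulation.

(* Main.v *)
(* Unfolding the inner least fixpoint, a quadruple is in [rbisimF R] iff after
   finitely many C-steps either C leaks a difference or an H-step into [R] is
   possible.  If [R] is a post-fixpoint and the C-traces agree, the first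
   alternative never occurs, so each H-leak matches in turn.  Conversely, the
   relation "equal C-traces imply equal H-traces" is itself a post-fixpoint:
   distinct C-traces differ after finitely many steps, and otherwise one H-step
   stays in the relation. *)
Require Import Defs.
From mathcomp Require Import all_boot boolp classical_sets.
Local Open Scope classical_set_scope.

Lemma rbisimFE (C H : transition_system) (R : rel4 C H)
    (s1 s2 : state C) (h1 h2 : state H) :
  rbisimF R (s1, s2, h1, h2) <->
  exists k, (@C_leak C H `|` H_step R)
    (iter k (@Defs.next C) s1, iter k (@Defs.next C) s2, h1, h2).
Proof.
have [fixF leastF] := rbisimFP R.
split.
  pose Y : rel4 C H := [set q | let: (s1, s2, h1, h2) := q in
    exists k, (@C_leak C H `|` H_step R)
      (iter k (@Defs.next C) s1, iter k (@Defs.next C) s2, h1, h2)].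
  (* [is_least_fixpoint] compares only with exact fixpoints, so both inclusions are shown for
     [Y]. *)
  suff YF : Psi R Y = Y by exact: (leastF Y YF).
  apply/seteqP; split=> -[[[t1 t2] g1] g2].
    case=> [[leakN | [k Yk]] | stepH]; first by exists 0; left.
      by exists k.+1; rewrite !iterSr.
    by exists 0; right.
  case=> -[[leakN | stepH] | k Yk]; first by left; left.
    by right.
  by left; right; exists k; rewrite -!iterSr.
case=> k; elim: k s1 s2 => [|k IHk] t1 t2; rewrite -fixF.
  by case=> [leakN | stepH]; [left; left | right].
by rewrite !iterSr => /IHk Fk; left; right.
Qed.

Lemma trace_iter (T : transition_system) (s t : state T) k :
  trace s = trace t -> trace (iter k (@Defs.next T) s) = trace (iter k (@Defs.next T) t).
Proof.
move=> st; apply/funext => n; rewrite /trace -!iterD.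
exact: (congr1 (@^~ (n + k)) st).
Qed.

Lemma trace_cons (T : transition_system) (s t : state T) :
  trace s = trace t <->
  leak s = leak t /\ trace (Defs.next s) = trace (Defs.next t).
Proof.
split=> [st | [leak_st next_st]].
  by split; [exact: (congr1 (@^~ 0) st) | exact: (@trace_iter T s t 1)].
apply/funext => -[//|n]; rewrite /trace !iterSr.
exact: (congr1 (@^~ n) next_st).
Qed.

Lemma rbisim_sound (C H : transition_system) (R : rel4 C H)
    (s1 s2 : state C) (h1 h2 : state H) :
  R `<=` rbisimF R -> R (s1, s2, h1, h2) ->
  trace s1 = trace s2 -> trace h1 = trace h2.
Proof.
move=> RF Rq ss; apply/funext => n.
(* Each position of the H-trace uses up one H-step, while the C-states advance by [k] steps and keep
   equal traces; hence the generalization over all four states. *)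
elim: n s1 s2 h1 h2 Rq ss => [|n IHn] t1 t2 g1 g2 /RF/rbisimFE[k] + tt;
  have /trace_cons[leak_tt _] := trace_iter _ _ _ k tt;
  case=> [/(_ leak_tt) // | [leak_gg Rk]] //.
rewrite /trace !iterSr; exact: (IHn _ _ _ _ Rk (trace_iter _ _ _ k tt)).
Qed.

Lemma rbisim_complete (C H : transition_system) :
  let R : rel4 C H := [set q | let: (s1, s2, h1, h2) := q in
    trace s1 = trace s2 -> trace h1 = trace h2] in
  R `<=` rbisimF R.
Proof.
move=> R [[[s1 s2] h1] h2] Rq; apply/rbisimFE.
have [ss | ss] := pselect (trace s1 = trace s2).
  have /trace_cons[leak_hh next_hh] := Rq ss.
  by exists 0; right; split=> /=.
have /existsNP[k leakN] : ~ forall k, trace s1 k = trace s2 k.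
  by move=> eq_s; apply: ss; apply/funext.
by exists k; left.
Qed.

Theorem theorem13 (C H : transition_system) (s1 s2 : state C) (h1 h2 : state H) :
  (trace s1 = trace s2 -> trace h1 = trace h2) <->
  exists R : set (state C * state C * state H * state H),
    R (s1, s2, h1, h2) /\ R `<=` rbisimF R.
Proof.
split=> [imp | [R [Rq RF]]]; last exact: rbisim_sound RF Rq.
(* Unification with [rbisim_complete] supplies [R]; membership is then [imp]. *)
by eexists; split; [| exact: rbisim_complete].
Qed.
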